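(* Let $X$ be a Banach lattice, real or complex. There exists a constant $K=K_X\in[1,\sqrt2]$ such that for any linearly independent $f,g\in X$ there exist $f',g'\in\operatorname{span}\{f,g\}$ with $$\min_{|\lambda|=1}\|f-\lambda g\|\leq K\min_{|\lambda|=1}\|f'-\lambda g'\|,$$ $$\big(\|f'\|^2+\|g'\|^2\big)^{1/2}\leq K\min_{|\lambda|=1}\|f'-\lambda g'\|,$$ and $$\big\||f|-|g|\big\|\geq\big\||f'|-|g'|\big\|.$$
   Context: The minima are over scalars $\lambda$ (real or complex, according to the scalar field of $X$) with $|\lambda|=1$, and the span is over the scalar field. A complex Banach lattice is the complexification $X_{\mathbb C}=X\oplus iX$ of a real Banach lattice $X$, with modulus $|x+iy|=\sup_{\theta\in[0,2\pi]}\{x\cos\theta+y\sin\theta\}\in X_+$ and norm $\|x+iy\|=\big\||x+iy|\big\|_X$. *)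

(* Defs.v *)
From HB Require Import structures.
From mathcomp Require Import all_boot all_order all_algebra.
From mathcomp Require Import all_classical all_reals all_analysis.
From mathcomp Require Import complex.

Set Implicit Arguments.
Unset Strict Implicit.
Unset Printing Implicit Defensive.

Import Order.TTheory GRing.Theory Num.Theory.
Import numFieldNormedType.Exports.

Local Open Scope classical_set_scope.
Local Open Scope ring_scope.
Local Open Scope complex_scope.

(* [Num.RealDomain] already joins an order with a normed module structure, so
   that the hierarchy admits no new structure inheriting from both: the order
   is therefore given by mixin fields and turned into a lattice structure just
   below, after which <=, [Order.meet] and [Order.join] are available. *)
HB.mixin Record isBanachLattice (R : realType) X
    of CompleteNormedModule R X := {
  blat_le : rel X ;
  blat_meet : X -> X -> X ;
  blat_join : X -> X -> X ;
  blat_le_refl : reflexive blat_le ;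
  blat_le_anti : antisymmetric blat_le ;
  blat_le_trans : transitive blat_le ;
  blat_lexI : forall x y z,
    blat_le x (blat_meet y z) = blat_le x y && blat_le x z ;
  blat_leUx : forall x y z,
    blat_le (blat_join x y) z = blat_le x z && blat_le y z ;
  blat_leD2r : forall z x y, blat_le x y -> blat_le (x + z) (y + z) ;
  blat_scale_ge0 : forall (a : R) (x : X),
    0 <= a -> blat_le 0 x -> blat_le 0 (a *: x) ;
  blat_le_norm : forall x y,
    blat_le (blat_join x (- x)) (blat_join y (- y)) -> `|x| <= `|y| }.

#[short(type="banachLatticeType")]
HB.structure Definition BanachLattice (R : realType) :=
  {X of CompleteNormedModule R X & isBanachLattice R X}.

Section BanachLatticeOrder.
Context (R : realType) (X : banachLatticeType R).

HB.instance Definition _ :=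
  Order.Le_isPOrder.Build ring_display (BanachLattice.sort X)
    (@blat_le_refl R X) (@blat_le_anti R X) (@blat_le_trans R X).

HB.instance Definition _ :=
  Order.POrder_isMeetSemilattice.Build ring_display (BanachLattice.sort X)
    (@blat_lexI R X).

HB.instance Definition _ :=
  Order.POrder_isJoinSemilattice.Build ring_display (BanachLattice.sort X)
    (@blat_leUx R X).

End BanachLatticeOrder.

(* The lattice modulus |x|; the notation [`|x|] is reserved for the norm. *)
Definition lmod (R : realType) (X : banachLatticeType R) (x : X) : X :=
  Order.join x (- x).

(* The pair (x, y) stands for x + i y. *)
Definition complexification (R : realType) (X : banachLatticeType R) : Type :=
  (X * X)%type.

Section Complexification.
Context (R : realType) (X : banachLatticeType R).
Local Notation XC := (complexification X).

HB.instance Definition _ := GRing.Zmodule.copy XC (X * X)%type.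

Definition cscale (a : R[i]) (z : XC) : XC :=
  (complex.Re a *: z.1 - complex.Im a *: z.2,
   complex.Re a *: z.2 + complex.Im a *: z.1).

Fact cscaleA a b z : cscale a (cscale b z) = cscale (a * b) z.
Proof.
case: a b z => [a1 a2] [b1 b2] [x y]; rewrite /cscale /=; congr pair.
  rewrite scalerBr scalerDr scalerBl scalerDl !scalerA !opprD.
  by rewrite [X in _ + X = _]addrC addrACA.
rewrite scalerBr scalerDr scalerBl scalerDl !scalerA.
by rewrite [X in _ + X = _]addrC addrACA.
Qed.

Fact cscale1 : left_id 1 cscale.
Proof. by case=> x y; rewrite /cscale /= !scale1r !scale0r subr0 addr0. Qed.

Fact cscaleDr : right_distributive cscale +%R.
Proof.
move=> [a b] [x y] [x' y']; rewrite /cscale /=; congr pair.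
  by rewrite !scalerDr opprD addrACA.
by rewrite !scalerDr addrACA.
Qed.

Fact cscaleDl z : {morph cscale^~ z : a b / a + b}.
Proof.
case: z => x y [a1 a2] [b1 b2]; rewrite /cscale /=; congr pair.
  by rewrite !scalerDl opprD addrACA.
by rewrite !scalerDl addrACA.
Qed.

HB.instance Definition _ :=
  GRing.Zmodule_isLmodule.Build R[i] XC cscaleA cscale1 cscaleDr cscaleDl.

(* In a Banach lattice this supremum always exists, so that the default value
   0 of [supremum] plays no role. *)
Definition cmod (z : XC) : X :=
  supremum 0 [set cos t *: z.1 + sin t *: z.2 | t in `[0, pi *+ 2]].

Definition cnorm (z : XC) : R := `|cmod z|.

End Complexification.

Section Phase.
Context (F : numDomainType) (V : lmodType F).

Definition lin_indep2 (f g : V) : Prop :=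
  forall a b : F, a *: f + b *: g = 0 -> a = 0 /\ b = 0.

Definition span2 (f g : V) : set V :=
  [set h | exists a b : F, h = a *: f + b *: g].

End Phase.

(* The least element of A if there is one, and 0 otherwise. *)
Definition minimum (R : realType) (A : set R) : R := xget 0 (A `&` lbound A).

(* By compactness of the unit circle the minimum is attained for the norms
   considered here. *)
Definition phase_dist (R : realType) (F : numDomainType) (V : lmodType F)
    (N : V -> R) (f g : V) : R :=
  minimum [set N (f - l *: g) | l in [set l : F | `|l| = 1]].

(* Main.v *)
Require Import Defs.
From mathcomp Require Import all_boot all_order all_algebra.
From mathcomp Require Import all_classical all_reals all_analysis.
From mathcomp Require Import complex ring lra.
Import Order.TTheory GRing.Theory Num.Theory.
Import numFieldNormedType.Exports.
Local Open Scope classical_set_scope.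
Local Open Scope ring_scope.

(** The constant is [K = sqrt 2] for both scalar fields.

    Real scalars. The phase distance is the smaller of [|f - g|] and [|f + g|], say of the
    diagonals [u] and [v] with [|u| <= |v|]. Replacing [v] by [t v] with [t |v| = |u|] keeps
    the phase distance and makes the sides [(t v +- u) / 2] no longer than it
    ([ex_balanced_pair]). The third inequality holds because [||f| - |g||] is the infimum of
    the moduli of [f - g] and [f + g] ([le_lmod_lmodB]), and both diagonals decrease.

    Complex scalars. Put [u = f - g] and [w = i (f + g)]. With [m = p - i q] of modulus [1],
    [f - m^2 g = m (p u + q w)]: up to a phase, the vectors [f - l g] run through a real
    ellipse ([phase_ellipse]). The phase distance [a] is the norm of the smallest vector on
    it, so this ellipse encloses all vectors of norm at most [a] in the real plane of [u]
    and [w]. Let [a u0] and [a w0] be the half-axes of an ellipse of maximal area inside the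
    ball of radius [a] ([ex_John_ellipse]), where inside is understood for complex
    coefficients:
    [N (x u0 + y w0)^2 <= |x|^2 + |y|^2]. Let [(f', g')] be the pair with these half-axes,
    [f' = a (u0 - i w0) / 2] and [g' = - a (u0 + i w0) / 2].
    - By John's argument the maximal ellipse contains the ball of radius [a / sqrt 2], so
      the phase distance of [(f', g')] is at least [a / sqrt 2].
    - The complex bound gives [|f'|^2 <= a^2 / 2] and [|g'|^2 <= a^2 / 2], so the sum of the
      squares is at most [a^2].
    - The new ellipse lies in the ball of radius [a], hence in the old ellipse. Since
      [||f| - |g||] is the infimum of the moduli of [f - l g] over the unit circle
      ([le_lmod_cmodB]), it decreases from the old ellipse to the new one
      ([lmod_cmodB_mono]).

    Everything is done with suprema in the abstract lattice rather than by a functional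
    representation. The modulus [|z|] exists by norm completeness ([ex_modulus]), and pointwise
    arguments about complex numbers become linear inequalities between the rotations of
    [z] and their supremum. *)

Set Implicit Arguments.
Unset Strict Implicit.
Unset Printing Implicit Defensive.

(** * Order and norm in a Banach lattice *)

Section LatticeBasics.
Context (R : realType) (X : banachLatticeType R).
Implicit Types (x y z a b h : X) (c e : R).

Lemma blat_leD2rE z x y : (x + z <= y + z) = (x <= y).
Proof.
apply/idP/idP => [H|]; last exact: blat_leD2r.
by rewrite -(addrK z x) -(addrK z y); apply: blat_leD2r.
Qed.

Lemma blat_leD x y z t : x <= y -> z <= t -> x + z <= y + t.
Proof.
move=> xy zt; apply: (@le_trans _ _ (y + z)); first by rewrite blat_leD2rE.
by rewrite ![y + _]addrC blat_leD2rE.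
Qed.

Lemma blat_subr_ge0 x y : (0 <= y - x) = (x <= y).
Proof. by rewrite -(blat_leD2rE x 0) add0r subrK. Qed.

Lemma blat_leBlDr x y z : (x - y <= z) = (x <= z + y).
Proof. by rewrite -(blat_leD2rE y (x - y)) subrK. Qed.

Lemma blat_leZ c x y : 0 <= c -> x <= y -> c *: x <= c *: y.
Proof.
move=> c0; rewrite -(blat_subr_ge0 x) -(blat_subr_ge0 (c *: x)) -scalerBr.
exact: blat_scale_ge0.
Qed.

Lemma blat_scaler_ge0 c x : 0 <= c -> 0 <= x -> 0 <= c *: x.
Proof. exact: blat_scale_ge0. Qed.

Lemma lmod_le x y : (lmod x <= y) = (x <= y) && (- x <= y).
Proof. exact: blat_leUx. Qed.

Lemma le_lmod x : x <= lmod x.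
Proof. by have := lexx (lmod x); rewrite lmod_le => /andP[]. Qed.

Lemma leN_lmod x : - x <= lmod x.
Proof. by have := lexx (lmod x); rewrite lmod_le => /andP[]. Qed.

Lemma lmodN x : lmod (- x) = lmod x.
Proof.
suff H y : lmod (- y) <= lmod y.
  by apply/le_anti; rewrite H -{1}[x]opprK H.
by rewrite lmod_le opprK leN_lmod le_lmod.
Qed.

Lemma blat_ge0_half x : 0 <= x + x -> 0 <= x.
Proof.
move=> x0; have : 0 <= 2^-1 *: (x + x) by rewrite -(scaler0 _ 2^-1); apply: blat_leZ.
by rewrite scalerDr -scalerDl (_ : 2^-1 + 2^-1 = 1 :> R) ?scale1r //; lra.
Qed.

Lemma lmod_ge0 x : 0 <= lmod x.
Proof.
by apply: blat_ge0_half; rewrite -(subrr x) blat_leD ?le_lmod ?leN_lmod.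
Qed.

Lemma blat_oppr_le0 x : (- x <= 0) = (0 <= x).
Proof. by rewrite -(blat_leD2rE x (- x)) addNr add0r. Qed.

Lemma lmod_id x : 0 <= x -> lmod x = x.
Proof.
move=> x0; apply/le_anti; rewrite le_lmod lmod_le lexx /= andbT.
by rewrite (le_trans _ x0) // blat_oppr_le0.
Qed.

Lemma lmodD x y : lmod (x + y) <= lmod x + lmod y.
Proof. by rewrite lmod_le opprD !blat_leD ?le_lmod ?leN_lmod. Qed.

Lemma lmodZ c x : lmod (c *: x) <= `|c| *: lmod x.
Proof.
rewrite lmod_le; case: (ger0P c) => c0.
  by rewrite -scalerN !blat_leZ ?le_lmod ?leN_lmod.
have {}c0 : 0 <= - c by rewrite oppr_ge0 ltW.
by rewrite -scaleNr blat_leZ ?le_lmod // -[c *: x]opprK -scaleNr -scalerN blat_leZ ?leN_lmod.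
Qed.

Lemma norm_le_lmod x y : lmod x <= lmod y -> `|x| <= `|y|.
Proof. exact: blat_le_norm. Qed.

Lemma blat_norm_le x y : 0 <= x -> x <= y -> `|x| <= `|y|.
Proof. by move=> x0 xy; apply: norm_le_lmod; rewrite !lmod_id // (le_trans x0). Qed.

Lemma norm_lmod x : `|lmod x| = `|x|.
Proof.
by apply/le_anti/andP; split; apply: norm_le_lmod; rewrite (lmod_id (lmod_ge0 _)).
Qed.

(** The positive cone is norm closed, because the positive part of [a - b] is
    dominated by the modulus of every error [d] with [a <= b + d]. *)
Lemma blat_le_approx a b :
  (forall e, 0 < e -> exists2 d, `|d| <= e & a <= b + d) -> a <= b.
Proof.
move=> H; pose p := Order.join (a - b) 0.
have p0 : 0 <= p by exact: leUr.
suff /normr0_eq0 p00 : `|p| = 0.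
  by rewrite -(blat_subr_ge0 a b) -blat_oppr_le0 opprB -p00 leUl.
apply/le_anti/andP; split => //; apply/ler_addgt0Pl => e e0; rewrite addr0.
have [d de ad] := H _ e0; apply: le_trans de; rewrite -(norm_lmod d).
apply: blat_norm_le => //; rewrite leUx lmod_ge0 andbT.
by apply: le_trans (le_lmod d); rewrite blat_leBlDr addrC.
Qed.

Lemma blat_archimedean a b h :
  (forall e, 0 < e -> a <= b + e *: h) -> a <= b.
Proof.
move=> H; apply: blat_le_approx => e e0.
have h0 : 0 < `|h| + 1 by rewrite ltr_wpDl.
exists ((e / (`|h| + 1)) *: h); last by apply: H; rewrite divr_gt0.
have eh : 0 <= e / (`|h| + 1) by rewrite ltW ?divr_gt0.
rewrite normrZ (ger0_norm eh) mulrAC ler_pdivrMr // ler_pM2l //.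
by rewrite lerDl.
Qed.

End LatticeBasics.

Section Suprema.
Context (R : realType) (X : banachLatticeType R).

(** A criterion for suprema that uses only norm completeness: each [s] is dominated by
    all upper bounds of [A] and is itself almost one, with error controlled by a fixed
    vector [h]. The approximants [s n] satisfy [s n <= s m + e m *: h] because the
    right-hand side bounds [A]; hence they form a Cauchy sequence, and the closedness of
    the positive cone turns their limit into the supremum. *)
Lemma ex_supremum_approx (A : set X) (h : X) :
  (forall e : R, 0 < e -> exists2 s, forall b, ubound A b -> s <= b &
     forall x, A x -> x <= s + e *: h) ->
  exists s, ubound A s /\ forall b, ubound A b -> s <= b.
Proof.
move=> H; pose e n : R := n.+1%:R^-1.
have e0 n : 0 < e n by rewrite invr_gt0.
have /choice [s Hs] n : exists s, (forall b, ubound A b -> s <= b) /\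
    forall x, A x -> x <= s + e n *: h.
  by have [s s1 s2] := H _ (e0 n); exists s.
have sD n m : s n <= s m + e m *: h.
  by apply: (Hs n).1 => x Ax; apply: (Hs m).2.
have e0' n : 0 <= e n := ltW (e0 n).
have eh n : e n *: h <= e n *: lmod h by rewrite blat_leZ ?le_lmod.
have elh n : 0 <= e n *: lmod h by rewrite blat_scaler_ge0 ?lmod_ge0.
have sD' n m k : s n - s m <= (e m + e k) *: lmod h.
  rewrite blat_leBlDr (le_trans (sD n m)) // addrC blat_leD2rE scalerDl.
  by rewrite (le_trans (eh m)) // -[X in X <= _]addr0 blat_leD.
have dist n m : `|s n - s m| <= (e n + e m) * `|h|.
  have -> : (e n + e m) * `|h| = `|(e n + e m) *: lmod h|.
    by rewrite normrZ norm_lmod ger0_norm // addr_ge0.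
  apply: norm_le_lmod; rewrite [X in _ <= X]lmod_id; last first.
    by rewrite blat_scaler_ge0 ?addr_ge0 ?lmod_ge0.
  rewrite lmod_le opprB; apply/andP; split; last exact: sD'.
  by rewrite [e n + _]addrC; exact: sD'.
have h0 : 0 < `|h| + 1 by rewrite ltr_wpDl.
have small eps : 0 < eps -> exists N, forall n, (N <= n)%N -> e n * (`|h| + 1) < eps.
  move=> eps0.
  have : e n @[n --> \oo] --> 0 by exact: cvg_harmonic.
  move/cvgrPdist_lt => /(_ (eps / (`|h| + 1))); rewrite divr_gt0 // => /(_ isT).
  case=> N _ HN; exists N => n /HN /=; rewrite sub0r normrN ger0_norm //.
  by rewrite ltr_pdivlMr.
have dist' N n : (N <= n)%N -> `|s n - s N| <= 2 * (e N * (`|h| + 1)).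
  move=> Nn; apply: le_trans (dist _ _) _.
  have : e n <= e N by rewrite lef_pV2 ?posrE // ler_nat.
  have := normr_ge0 h; have := e0' N; have := e0' n; nra.
have /cauchy_cvgP cs : cauchy (s n @[n --> \oo]).
  apply: cauchy_exP => eps eps0.
  have [|N HN] := small (eps / 2); first by rewrite divr_gt0.
  exists (s N), N => // n /= Nn; rewrite -ball_normE /= distrC.
  by apply: le_lt_trans (dist' _ _ Nn) _; rewrite mulrC -ltr_pdivlMr // HN.
pose l := lim (s n @[n --> \oo]).
have approx eps : 0 < eps -> exists n, `|l - s n| <= eps /\ `|e n *: h| <= eps.
  move=> eps0; have [N HN] := small _ eps0.
  move/cvgrPdist_le: cs => /(_ _ eps0) [M _ HM].
  exists (maxn N M); split; first by apply: HM; rewrite /= leq_maxr.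
  rewrite normrZ ger0_norm //; apply/ltW.
  apply: le_lt_trans (HN _ (leq_maxl N M)).
  by rewrite ler_pM2l // lerDl.
exists l; split.
  move=> x Ax; apply: blat_le_approx => eps eps0.
  have [|n [n1 n2]] := approx (eps / 2); first by rewrite divr_gt0.
  exists (s n - l + e n *: h); last by rewrite addrA [l + _]addrC subrK; apply: (Hs n).2.
  by rewrite (le_trans (ler_normD _ _)) // distrC [eps]splitr lerD.
move=> b ub; apply: blat_le_approx => eps eps0; have [n [n1 _]] := approx _ eps0.
exists (l - s n) => //; rewrite -[X in X <= _](subrK (s n)) [b + _]addrC.
rewrite blat_leD //.
exact: (Hs n).1.
Qed.

End Suprema.

(** * Existence and characterisation of the complex modulus *)

Section Circle.
Context (R : realType).

Lemma circle_param (p q : R) : p ^+ 2 + q ^+ 2 = 1 ->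
  exists2 t, 0 <= t <= pi *+ 2 & p = cos t /\ q = sin t.
Proof.
move=> pq; have p1 : -1 <= p <= 1 by nra.
have p1' : p \in `[(-1), 1] by rewrite in_itv.
have q2 : Num.sqrt (1 - p ^+ 2) = `|q| by rewrite -pq addrAC subrr add0r sqrtr_sqr.
have := pi_ge0 R; have := acos_ge0 p1; have := acos_lepi p1 => ap a0 pi0.
have [q0|q0] := leP 0 q.
  exists (acos p); first by rewrite a0 /= mulr2n; lra.
  by rewrite acosK // sin_acos // q2 ger0_norm.
exists (pi *+ 2 - acos p); first by rewrite mulr2n; lra.
rewrite addrC cosD2pi cosN acosK //; split => //.
by rewrite sinD2pi sinN sin_acos // q2 ltr0_norm // opprK.
Qed.

Lemma cos_lipschitz (a b : R) : `|cos a - cos b| <= `|a - b|.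
Proof.
wlog ab : a b / b <= a.
  by move=> H; case/orP: (le_total b a) => ab; last rewrite distrC [leRHS]distrC; exact: H.
have [|c _ ->] := @MVT_segment R cos (fun x => - sin x) b a ab.
  exact/continuous_subspaceT/continuous_cos.
rewrite normrM normrN ler_piMl // ler_norml.
by rewrite sin_geN1 sin_le1.
Qed.

Lemma sin_lipschitz (a b : R) : `|sin a - sin b| <= `|a - b|.
Proof.
wlog ab : a b / b <= a.
  by move=> H; case/orP: (le_total b a) => ab; last rewrite distrC [leRHS]distrC; exact: H.
have [|c _ ->] := @MVT_segment R sin (fun x => cos x) b a ab.
  exact/continuous_subspaceT/continuous_sin.
by rewrite normrM ler_piMl // ler_norml cos_geN1 cos_le1.
Qed.

End Circle.

Section Modulus.
Context (R : realType) (X : banachLatticeType R).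
Implicit Types (z w : complexification X) (b : X).

Lemma ex_finite_lub (F : nat -> X) (M : nat) :
  exists2 s, (forall b, (forall k, (k <= M)%N -> F k <= b) -> s <= b) &
    forall k, (k <= M)%N -> F k <= s.
Proof.
elim: M => [|M [s s1 s2]].
  exists (F 0%N) => [b|k]; first exact.
  by rewrite leqn0 => /eqP ->.
exists (Order.join s (F M.+1)) => [b H|k].
  by rewrite leUx s1 ?H // => k kM; apply: H; rewrite ltnW.
rewrite leq_eqVlt ltnS => /orP[/eqP ->|/s2 ks]; first by rewrite leUr.
by rewrite (le_trans ks) // leUl.
Qed.

Lemma blat_leZ_norm (c : R) (x : X) : c *: x <= `|c| *: lmod x.
Proof. exact: le_trans (le_lmod _) (lmodZ _ _). Qed.

Lemma blat_leZl (c d : R) (x : X) : 0 <= x -> c <= d -> c *: x <= d *: x.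
Proof.
move=> x0 cd; rewrite -(blat_subr_ge0 (c *: x)) -scalerBl blat_scaler_ge0 //.
by rewrite subr_ge0.
Qed.

(** The supremum exists although [X] need not be Dedekind complete: by the
    Lipschitz bounds on [cos] and [sin], the supremum over a grid of mesh [e] is
    within [e *: (lmod x + lmod y)] of being an upper bound. *)
Lemma ex_modulus (x y : X) :
  exists s, ubound [set cos t *: x + sin t *: y | t in `[0, pi *+ 2]] s /\
  forall b, ubound [set cos t *: x + sin t *: y | t in `[0, pi *+ 2]] b -> s <= b.
Proof.
set A := (X in ubound X).
pose f (t : R) : X := cos t *: x + sin t *: y.
apply: (@ex_supremum_approx R X A (lmod x + lmod y)) => e e0.
have pi2 : 0 <= pi *+ 2 :> R by rewrite mulrn_wge0 // pi_ge0.
pose g k : R := Num.min (k%:R * e) (pi *+ 2).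
pose M := Num.truncn ((pi *+ 2 : R) / e).
have [s s1 s2] := ex_finite_lub (fun k => f (g k)) M.
exists s => [b ub|_ [t /= + <-]].
  apply: s1 => k _; apply: ub; exists (g k) => //=.
  by rewrite in_itv /= /g le_min ge_min lexx pi2 orbT !andbT mulr_ge0 // ltW.
rewrite in_itv /= => /andP[t0 t2].
pose k := Num.truncn (t / e).
have te0 : 0 <= t / e by rewrite divr_ge0 // ltW.
have /andP[kt tk] : k%:R <= t / e < k.+1%:R by rewrite truncn_itv.
have kM : (k <= M)%N.
  by rewrite /k /M le_truncn // ler_pM2r ?invr_gt0.
have ke : k%:R * e <= t by rewrite -ler_pdivlMr.
have te : t < k%:R * e + e by rewrite -[X in _ + X]mul1r -mulrDl natr1 -ltr_pdivrMr.
have gk : g k = k%:R * e by rewrite /g; apply/min_idPl/(le_trans ke).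
have d : `|t - g k| <= e by rewrite gk ler_norml; lra.
have := s2 _ kM; rewrite -(blat_leD2rE (e *: (lmod x + lmod y))).
apply: le_trans; rewrite [X in _ <= X]addrC -blat_leBlDr.
rewrite opprD addrACA -!scalerBl scalerDr blat_leD //.
  apply: le_trans (blat_leZ_norm _ _) _; rewrite blat_leZl ?lmod_ge0 //.
  exact: le_trans (cos_lipschitz _ _) d.
apply: le_trans (blat_leZ_norm _ _) _; rewrite blat_leZl ?lmod_ge0 //.
exact: le_trans (sin_lipschitz _ _) d.
Qed.

Lemma cmod_supremum z :
  let A := [set cos t *: z.1 + sin t *: z.2 | t in `[0, pi *+ 2]] in
  ubound A (cmod z) /\ forall b, ubound A b -> cmod z <= b.
Proof.
move=> A; have [s [s1 s2]] := ex_modulus z.1 z.2.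
rewrite /cmod /supremum -/A; case: ifPn => [/eqP A0|_].
  have : A (cos 0 *: z.1 + sin 0 *: z.2).
    by exists 0 => //=; rewrite in_itv /= lexx mulrn_wge0 // pi_ge0.
  by rewrite A0.
by case: xgetP => [y _ [y1 y2]|/(_ s) []] //.
Qed.

(** Points of the unit circle replace angles, so that later arguments are polynomial. *)
Lemma cmod_leP z b : reflect
  (forall p q : R, p ^+ 2 + q ^+ 2 = 1 -> p *: z.1 + q *: z.2 <= b) (cmod z <= b).
Proof.
apply: (iffP idP) => [sb p q /circle_param [t t01 [-> ->]]|H].
  by apply: le_trans sb; apply: (cmod_supremum z).1; exists t => //=; rewrite in_itv.
by apply: (cmod_supremum z).2 => _ [t _ <-]; apply: H; exact: cos2Dsin2.
Qed.

Lemma le_cmod z (p q : R) : p ^+ 2 + q ^+ 2 = 1 -> p *: z.1 + q *: z.2 <= cmod z.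
Proof. by move: p q; apply/cmod_leP. Qed.

Lemma le_cmodZ z (p q r : R) : 0 <= r -> p ^+ 2 + q ^+ 2 = r ^+ 2 ->
  p *: z.1 + q *: z.2 <= r *: cmod z.
Proof.
rewrite le_eqVlt => /orP[/eqP <-|r0 pq].
  rewrite expr0n /= => /eqP; rewrite paddr_eq0 ?sqr_ge0 // !sqrf_eq0 => /andP[/eqP -> /eqP ->].
  by rewrite !scale0r addr0.
have -> : p *: z.1 + q *: z.2 = r *: ((p / r) *: z.1 + (q / r) *: z.2).
  by rewrite scalerDr !scalerA; congr (_ *: _ + _ *: _); field; rewrite gt_eqF.
apply: blat_leZ (ltW r0) _; apply: le_cmod.
by rewrite !expr_div_n -mulrDl pq divff // expf_neq0 // gt_eqF.
Qed.

End Modulus.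

(** * The complex modulus and norm *)

Section ComplexModulus.
Local Open Scope complex_scope.
Context (R : realType) (X : banachLatticeType R).
Local Notation XC := (complexification X).
Implicit Types (z w f g : XC) (h : X) (l : R[i]).

Lemma cmod_ge0 z : 0 <= cmod z.
Proof.
apply: blat_ge0_half.
have := blat_leD (@le_cmod _ _ z 1 0 _) (@le_cmod _ _ z (-1) 0 _).
rewrite !scale0r !addr0 scaleN1r scale1r subrr; apply.
  by rewrite expr1n expr0n addr0.
by rewrite sqrrN expr1n expr0n addr0.
Qed.

Lemma cmodD z w : cmod (z + w) <= cmod z + cmod w.
Proof.
apply/cmod_leP => p q pq; rewrite /= !scalerDr addrACA.
by rewrite blat_leD ?le_cmod.
Qed.

Lemma normc_ge0 l : 0 <= Normc.normc l.
Proof. by case: l => a b; exact: sqrtr_ge0. Qed.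

Lemma normc_sqr l : Normc.normc l ^+ 2 = complex.Re l ^+ 2 + complex.Im l ^+ 2.
Proof. by case: l => a b; rewrite /= sqr_sqrtr // addr_ge0 ?sqr_ge0. Qed.

(** Multiplication by [l] permutes the rotations of [z] up to the factor [|l|];
    applying the same bound to [l^-1] gives equality. *)
Lemma cmodZ l z : cmod (l *: z) = Normc.normc l *: cmod z.
Proof.
have le (k : R[i]) (v : XC) : cmod (k *: v) <= Normc.normc k *: cmod v.
  apply/cmod_leP => p q pq.
  rewrite [(k *: v).1]/(complex.Re k *: v.1 - complex.Im k *: v.2).
  rewrite [(k *: v).2]/(complex.Re k *: v.2 + complex.Im k *: v.1).
  have -> : p *: (complex.Re k *: v.1 - complex.Im k *: v.2) +
     q *: (complex.Re k *: v.2 + complex.Im k *: v.1) =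
     (p * complex.Re k + q * complex.Im k) *: v.1 +
     (q * complex.Re k - p * complex.Im k) *: v.2.
    rewrite !scalerDr !scalerDl scalerN !scaleNr !scalerA -!addrA; congr (_ + _).
    by rewrite addrC -!addrA addrC -!addrA; congr (_ + _); rewrite addrC.
  apply: le_cmodZ; first exact: normc_ge0.
  by rewrite normc_sqr -[RHS]mul1r -pq; ring.
apply/le_anti; rewrite le /=.
have [->|l0] := eqVneq l 0; first by rewrite Normc.normc0 !scale0r cmod_ge0.
have := le l^-1 (l *: z); rewrite scalerA mulVf // scale1r Normc.normcV.
move/(blat_leZ (normc_ge0 l)); rewrite scalerA divff ?scale1r //.
by apply: contra_neq l0; exact: Normc.eq0_normc.
Qed.

Lemma cmod_unit l z : Normc.normc l = 1 -> cmod (l *: z) = cmod z.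
Proof. by move=> l1; rewrite cmodZ l1 scale1r. Qed.

Lemma cmodN z : cmod (- z) = cmod z.
Proof. by rewrite -scaleN1r cmod_unit //= oppr0 sqrrN expr1n expr0n addr0 sqrtr1. Qed.

Lemma cmodBC z w : cmod (z - w) = cmod (w - z).
Proof. by rewrite -cmodN opprB. Qed.

Lemma lmod_fst_le z : lmod z.1 <= cmod z.
Proof.
rewrite lmod_le; apply/andP; split.
  have := @le_cmod _ _ z 1 0; rewrite scale0r addr0 scale1r; apply.
  by rewrite expr1n expr0n addr0.
have := @le_cmod _ _ z (-1) 0; rewrite scale0r addr0 scaleN1r; apply.
by rewrite sqrrN expr1n expr0n addr0.
Qed.

Lemma lmod_snd_le z : lmod z.2 <= cmod z.
Proof.
rewrite lmod_le; apply/andP; split.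
  have := @le_cmod _ _ z 0 1; rewrite scale0r add0r scale1r; apply.
  by rewrite expr1n expr0n add0r.
have := @le_cmod _ _ z 0 (-1); rewrite scale0r add0r scaleN1r; apply.
by rewrite sqrrN expr1n expr0n add0r.
Qed.

Lemma cmod_le_lmodD z : cmod z <= lmod z.1 + lmod z.2.
Proof.
apply/cmod_leP => p q pq; rewrite blat_leD // (le_trans (blat_leZ_norm _ _)) //.
  rewrite -[X in _ <= X]scale1r blat_leZl ?lmod_ge0 // ler_norml; nra.
by rewrite -[X in _ <= X]scale1r blat_leZl ?lmod_ge0 // ler_norml; nra.
Qed.

Lemma lmod0 : lmod (0 : X) = 0.
Proof. by rewrite lmod_id. Qed.

Definition ofreal (x : X) : XC := (x, 0).

Lemma cmod_ofreal (x : X) : cmod (ofreal x) <= lmod x.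
Proof. by apply: le_trans (cmod_le_lmodD _) _; rewrite lmod0 addr0. Qed.

Lemma lmod_eq0 (x : X) : lmod x <= 0 -> x = 0.
Proof.
move=> x0; apply/normr0_eq0; rewrite -norm_lmod.
by have -> : lmod x = 0; [apply/le_anti; rewrite x0 lmod_ge0 | rewrite normr0].
Qed.

Lemma cmod_eq0 z : cmod z = 0 -> z = 0.
Proof.
move=> z0; have := lmod_snd_le z; have := lmod_fst_le z; rewrite z0.
by case: z {z0} => x y /= /lmod_eq0 -> /lmod_eq0 ->.
Qed.

Lemma cnorm_eq0 z : cnorm z = 0 -> z = 0.
Proof. by move/normr0_eq0/cmod_eq0. Qed.

Lemma cnormD z w : cnorm (z + w) <= cnorm z + cnorm w.
Proof.
apply: le_trans (ler_normD _ _); apply: blat_norm_le (cmodD _ _).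
exact: cmod_ge0.
Qed.

Lemma cnormZ l z : cnorm (l *: z) = Normc.normc l * cnorm z.
Proof. by rewrite /cnorm cmodZ normrZ ger0_norm // normc_ge0. Qed.

(** * The infimum of the moduli of [f - l g] *)

Lemma lmod_cmodB z w : lmod (cmod z - cmod w) <= cmod (z - w).
Proof.
rewrite lmod_le opprB !blat_leBlDr; apply/andP; split.
  by rewrite -[X in cmod X <= _](subrK w) cmodD.
by rewrite [X in _ <= X + _]cmodBC -[X in cmod X <= _](subrK z) cmodD.
Qed.

(** For complex numbers, [z] is close to [|z|] as soon as [Re z] is: the
    imaginary part satisfies [|Im z| <= e |z| + (|z| - Re z) / (2 e)], which is
    [C Re z +- Im z <= sqrt (1 + C^2) |z|] with [C = 1 / (2 e)] and
    [sqrt (1 + C^2) <= C + e]. *)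
Lemma cmod_sub_real_le (e : R) z : 0 < e ->
  cmod (z - ofreal (cmod z)) <= e *: cmod z + (1 + (2 * e)^-1) *: (cmod z - z.1).
Proof.
move=> e0; set C := (2 * e)^-1; set m := cmod z.
have C0 : 0 < C by rewrite invr_gt0 mulr_gt0.
have Ce : C * e = 2^-1 by rewrite /C; field; rewrite gt_eqF.
have zm : z.1 <= m by apply: le_trans (lmod_fst_le z); exact: le_lmod.
have im (s : R) : s ^+ 2 = 1 -> s *: z.2 <= e *: m + C *: (m - z.1).
  move=> s1; have : C *: z.1 + s *: z.2 <= (C + e) *: m.
    apply: le_trans (_ : Num.sqrt (1 + C ^+ 2) *: m <= _).
      apply: le_cmodZ; first exact: sqrtr_ge0.
      by rewrite sqr_sqrtr ?s1 1?addrC // addr_ge0 ?sqr_ge0.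
    apply: blat_leZl; first exact: cmod_ge0.
    rewrite -(ger0_norm (_ : 0 <= C + e)) ?addr_ge0 ?(ltW C0) ?(ltW e0) // -sqrtr_sqr.
    by rewrite ler_wsqrtr //; nra.
  rewrite addrC -(blat_leD2rE (- (C *: z.1)) (s *: z.2 + _)) addrK => H; apply: le_trans H _.
  by rewrite scalerDl scalerBr addrAC addrC.
rewrite scalerDl scale1r addrCA; apply: le_trans (cmod_le_lmodD _) _.
rewrite blat_leD //.
  rewrite /= -lmodN opprB lmod_id // /ofreal /=.
  by rewrite blat_subr_ge0.
rewrite /= subr0 lmod_le -[- z.2]scaleN1r -{1}[z.2]scale1r.
by rewrite !im // ?sqrrN expr1n.
Qed.

(** If [h] exceeds [s] only by a multiple of each gap [|z| - Re (l z)], then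
    [h <= s], since no positive amount can be subtracted from the supremum [|z|]. *)
Lemma le_of_rotation_gaps (C : R) z h (s : X) : 0 < C ->
  (forall l, Normc.normc l = 1 -> h <= s + C *: (cmod z - (l *: z).1)) -> h <= s.
Proof.
move=> C0 H; suff : cmod z <= cmod z - C^-1 *: (h - s).
  rewrite -(blat_leD2rE (- cmod z) (cmod z)) subrr addrAC subrr add0r.
  move/(blat_leZ (ltW C0)); rewrite scaler0 scalerN scalerA divff ?gt_eqF //.
  by rewrite scale1r opprB blat_subr_ge0.
apply/cmod_leP => p q pq.
have nl : Normc.normc (Complex p (- q)) = 1 by rewrite /= sqrrN pq sqrtr1.
have := H _ nl; rewrite [(_ *: z).1]/(p *: z.1 - (- q) *: z.2) scaleNr opprK.
rewrite [s + _]addrC -blat_leBlDr => /(blat_leZ (ltW (_ : 0 < C^-1))).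
rewrite invr_gt0 => /(_ C0); rewrite [in X in _ <= X]scalerA mulVf ?gt_eqF // scale1r.
set a := C^-1 *: _; set b := p *: _ + _ => ab.
by rewrite -(blat_leD2rE a) subrK addrC -(blat_leD2rE (- b)) addrK.
Qed.

(** This is obvious for complex numbers, where one rotates [f] and [g] to their moduli.
    In [X] no single rotation works, but the triangle inequality through [|f|] and
    [|g|] bounds [|a f - b g|] by [||f| - |g||], a term [e (|f| + |g|)] and multiples
    of the gaps [|f| - Re (a f)] and [|g| - Re (b g)]. As [a] and [b] vary
    independently, [le_of_rotation_gaps] removes the gaps one after the other, and
    then [e] tends to [0]. With [lmod_cmodB] this makes [||f| - |g||] the infimum of
    the moduli of [f - l g]. *)
Lemma le_lmod_cmodB f g h :
  (forall l, Normc.normc l = 1 -> h <= cmod (f - l *: g)) ->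
  h <= lmod (cmod f - cmod g).
Proof.
move=> H; have {}H a b : Normc.normc a = 1 -> Normc.normc b = 1 ->
    h <= cmod (a *: f - b *: g).
  move=> a1 b1; have a0 : a != 0.
    by apply: contra_eq_neq a1 => ->; rewrite Normc.normc0 eq_sym oner_neq0.
  have -> : a *: f - b *: g = a *: (f - (a^-1 * b) *: g).
    by rewrite scalerBr scalerA mulrA divff // mul1r.
  by rewrite cmod_unit // H // Normc.normcM Normc.normcV a1 b1 invr1 mul1r.
apply: (@blat_archimedean _ _ _ _ (cmod f + cmod g)) => e e0.
pose C := 1 + (2 * e)^-1; have C0 : 0 < C by rewrite addr_gt0 // invr_gt0 mulr_gt0.
apply: (le_of_rotation_gaps C0 (z := f)) => a a1.
apply: (le_of_rotation_gaps C0 (z := g)) => b b1.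
apply: le_trans (H a b a1 b1) _.
have -> : a *: f - b *: g = (a *: f - ofreal (cmod f)) +
    ofreal (cmod f - cmod g) + - (b *: g - ofreal (cmod g)).
  move: (a *: f) (b *: g) => [z1 z2] [w1 w2].
  rewrite /ofreal; congr pair => /=; last by rewrite oppr0 !addr0.
  by rewrite opprB !addrA !subrK.
apply: le_trans (cmodD _ _) _; rewrite cmodN.
have := cmod_sub_real_le (b *: g) e0; have := cmod_sub_real_le (a *: f) e0.
rewrite !cmod_unit // -/C => Hf Hg.
apply: le_trans (blat_leD (le_trans (cmodD _ _) (blat_leD Hf (cmod_ofreal _))) Hg) _.
rewrite [e *: (_ + _)]scalerDr.
set x1 := e *: cmod f; set x2 := C *: _; set x3 := lmod _; set x4 := e *: _.
set x5 := C *: _.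
rewrite (_ : x1 + x2 + x3 + (x4 + x5) = x3 + (x1 + x4) + x2 + x5) //.
rewrite !addrA; congr (_ + _); rewrite [x1 + x2 + x3]addrC !addrA -!addrA.
by congr (_ + (_ + _)); rewrite addrC.
Qed.

End ComplexModulus.

(** * Seminorms and the phase distance *)

Definition seminorm (R : realType) (V : lmodType (complex R)) (N : V -> R) :=
  (forall x y, N (x + y) <= N x + N y) /\
  (forall l x, N (l *: x) = Normc.normc l * N x).

Section Seminorm.
Local Open Scope complex_scope.
Context (R : realType) (V : lmodType R[i]) (N : V -> R) (Nsemi : seminorm N).
Implicit Types (x y u w f g : V) (p q : R) (l a b : R[i]).

Lemma seminormD x y : N (x + y) <= N x + N y.
Proof. exact: Nsemi.1. Qed.

Lemma seminormZ l x : N (l *: x) = Normc.normc l * N x.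
Proof. exact: Nsemi.2. Qed.

Lemma seminorm0 : N 0 = 0.
Proof. by rewrite -(scale0r 0) seminormZ Normc.normc0 mul0r. Qed.

Lemma seminormN x : N (- x) = N x.
Proof. by rewrite -scaleN1r seminormZ /= oppr0 sqrrN expr1n expr0n addr0 sqrtr1 mul1r. Qed.

Lemma seminorm_ge0 x : 0 <= N x.
Proof. by have := seminormD x (- x); rewrite subrr seminorm0 seminormN; lra. Qed.

Lemma normc_real p : Normc.normc (p%:C) = `|p|.
Proof. by rewrite /= expr0n addr0 sqrtr_sqr. Qed.

Lemma seminormB_le x y : `|N x - N y| <= N (x - y).
Proof.
have := seminormD (x - y) y; rewrite subrK.
have := seminormD (y - x) x; rewrite subrK -opprB seminormN.
by rewrite ler_norml; lra.
Qed.

(** Continuity with respect to the topology of a seminorm; [V] itself carries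
    no topology. *)
Definition seminorm_continuous_at (T : topologicalType) (F : T -> V) (t : T) :=
  N (F s - F t) @[s --> t] --> 0.

Lemma seminorm_continuous_cst (T : topologicalType) x (t : T) :
  seminorm_continuous_at (fun=> x) t.
Proof. by rewrite /seminorm_continuous_at subrr seminorm0; exact: cvg_cst. Qed.

Lemma seminorm_continuousD (T : topologicalType) (F G : T -> V) t :
  seminorm_continuous_at F t -> seminorm_continuous_at G t ->
  seminorm_continuous_at (fun s => F s + G s) t.
Proof.
move=> cF cG; apply: (@squeeze_cvgr _ _ _ _ (cst 0) (fun s => N (F s - F t) + N (G s - G t))).
- by near=> s; rewrite /= seminorm_ge0 opprD addrACA seminormD.
- exact: cvg_cst.
- by have := cvgD cF cG; rewrite addr0; apply.
Unshelve. all: by end_near.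
Qed.

Lemma seminorm_continuousZ (T : topologicalType) (c : T -> R) x t :
  {for t, continuous c} -> seminorm_continuous_at (fun s => (c s)%:C *: x) t.
Proof.
move=> cc; rewrite /seminorm_continuous_at.
under eq_fun do rewrite -scalerBl -rmorphB seminormZ normc_real.
have c0 : `|c s - c t| @[s --> t] --> (0 : R).
  have := cvg_norm (cvgB cc (cvg_cst (c t))); rewrite subrr normr0; apply.
by have := cvgM c0 (cvg_cst (N x)); rewrite mul0r; apply.
Qed.

Lemma continuous_seminorm (T : topologicalType) (F : T -> V) t :
  seminorm_continuous_at F t -> {for t, continuous (N \o F)}.
Proof.
move=> cF; apply/cvgrPdist_le => e e0; move/cvgrPdist_le: cF => /(_ _ e0).
apply: filterS => s; rewrite sub0r normrN ger0_norm ?seminorm_ge0 //= distrC.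
by apply: le_trans; exact: seminormB_le.
Qed.

End Seminorm.

Lemma minimum_eq (R : realType) (A : set R) m : A m -> lbound A m -> minimum A = m.
Proof.
move=> Am lAm; rewrite /minimum; case: xgetP => [y _ [Ay lAy]|/(_ m) []] //.
by apply/le_anti; rewrite lAy // lAm.
Qed.

Section PhaseDistance.
Local Open Scope complex_scope.
Context (R : realType) (V : lmodType R[i]) (N : V -> R) (Nsemi : seminorm N).
Implicit Types (u w f g : V) (p q : R) (l : R[i]).

Lemma norm_unitP l : (`|l| = 1) <-> (Normc.normc l = 1).
Proof.
rewrite [`|l|]/((Normc.normc l)%:C); split => [|->] //.
by move/(congr1 (@complex.Re R)).
Qed.

Definition rcomb u w p q : V := p%:C *: u + q%:C *: w.

(** Writing [l = m ^+ 2] with [m = p - i q] turns the circle of all [f - l g] into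
    the real ellipse spanned by [f - g] and [i (f + g)], up to the phase [m]. *)
Lemma phase_ellipse f g p q : p ^+ 2 + q ^+ 2 = 1 ->
  f - ((p -i* q) ^+ 2) *: g = (p -i* q) *: rcomb (f - g) ('i *: (f + g)) p q.
Proof.
move=> pq; rewrite /rcomb !(scalerBr, scalerDr, scalerA).
have E1 : (p -i* q) * p%:C + (p -i* q) * q%:C * 'i = 1.
  by apply/eqP; rewrite eq_complex /=; apply/andP; split; apply/eqP => /=; nra.
have E2 : - ((p -i* q) * p%:C) + (p -i* q) * q%:C * 'i = - (p -i* q) ^+ 2.
  by apply/eqP; rewrite expr2 eq_complex /=; apply/andP; split; apply/eqP => /=; ring.
by rewrite addrACA -scalerDl E1 scale1r -!scaleNr -scalerDl E2.
Qed.

Lemma normc_unit p q : p ^+ 2 + q ^+ 2 = 1 -> Normc.normc (p -i* q) = 1.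
Proof. by move=> pq; rewrite /= sqrrN pq sqrtr1. Qed.

Lemma phase_circle l : Normc.normc l = 1 ->
  exists p q, p ^+ 2 + q ^+ 2 = 1 /\ l = (p -i* q) ^+ 2.
Proof.
move=> l1; case E : (sqrtc l) => [p q].
have lE : l = (p +i* q) ^+ 2 by rewrite -E sqr_sqrtc.
exists p, (- q); rewrite opprK; split => //.
by move: l1; rewrite lE expr2 Normc.normcM -expr2 normc_sqr sqrrN.
Qed.

Lemma phase_dist_attained f g : exists l, `|l| = 1 /\
  phase_dist N f g = N (f - l *: g) /\
  forall k, `|k| = 1 -> phase_dist N f g <= N (f - k *: g).
Proof.
pose F (t : R) : V := f + ((- cos t)%:C *: g + (- sin t)%:C *: ('i *: g)).
have FE t : F t = f - (cos t +i* sin t) *: g.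
  rewrite /F scalerA -scalerDl -scaleNr; congr (_ + _ *: _).
  by apply/eqP; rewrite eq_complex /=; apply/andP; split; apply/eqP => /=; ring.
have cF : {within `[0, pi *+ 2], continuous (N \o F)}.
  apply: continuous_subspaceT => t; apply: (continuous_seminorm Nsemi).
  apply: (seminorm_continuousD Nsemi); first exact: (seminorm_continuous_cst Nsemi).
  apply: (seminorm_continuousD Nsemi); apply: (seminorm_continuousZ Nsemi).
    by apply: continuousN; exact: continuous_cos.
  by apply: continuousN; exact: continuous_sin.
have pi2 : 0 <= pi *+ 2 :> R by rewrite mulrn_wge0 // pi_ge0.
have [t0 _ Hmin] := EVT_min pi2 cF.
have unit t : `|cos t +i* sin t| = 1 :> R[i].
  by apply/norm_unitP; rewrite /= cos2Dsin2 sqrtr1.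
have lb k : `|k| = 1 -> N (F t0) <= N (f - k *: g).
  case: k => a b /norm_unitP k1.
  have [|t t01 [-> ->]] := @circle_param R a b; first by rewrite -(normc_sqr (a +i* b)) k1 expr1n.
  by rewrite -FE; apply: Hmin; rewrite in_itv.
have -> : phase_dist N f g = N (F t0).
  apply: minimum_eq; first by exists (cos t0 +i* sin t0); rewrite ?FE //=.
  by move=> _ [k /= k1 <-]; exact: lb.
by exists (cos t0 +i* sin t0); rewrite unit FE -FE; split.
Qed.

(** In the norm [N], the phase distance is therefore the inner radius of that ellipse. *)
Lemma phase_dist_ellipse f g :
  let E := rcomb (f - g) ('i *: (f + g)) in
  (exists p q, p ^+ 2 + q ^+ 2 = 1 /\ phase_dist N f g = N (E p q)) /\
  forall p q, p ^+ 2 + q ^+ 2 = 1 -> phase_dist N f g <= N (E p q).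
Proof.
move=> E; have [l [/norm_unitP l1 [-> lb]]] := phase_dist_attained f g.
have NE p q : p ^+ 2 + q ^+ 2 = 1 -> N (f - (p -i* q) ^+ 2 *: g) = N (E p q).
  by move=> pq; rewrite phase_ellipse // (seminormZ Nsemi) normc_unit // mul1r.
split.
  by have [p [q [pq ->]]] := phase_circle l1; exists p, q; rewrite NE.
move=> p q pq; rewrite -NE //; apply: lb; apply/norm_unitP.
by rewrite expr2 Normc.normcM normc_unit // mulr1.
Qed.

End PhaseDistance.

(** * Ellipses of maximal area in a planar unit ball *)

Section JohnEllipse.
Local Open Scope complex_scope.
Context (R : realType) (V : lmodType R[i]) (N : V -> R) (Nsemi : seminorm N).
Implicit Types (u w : V) (p q r s c d : R) (a b : R[i]).

Let NZ := seminormZ Nsemi.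
Let ND := seminormD Nsemi.
Let N0 := seminorm_ge0 Nsemi.

Lemma sqr_leE (x y : R) : 0 <= x -> 0 <= y -> (x ^+ 2 <= y ^+ 2) = (x <= y).
Proof. by move=> x0 y0; rewrite ler_pXn2r // nnegrE. Qed.

Lemma rcomb_comb u w a b p q r s :
  a *: rcomb u w p q + b *: rcomb u w r s =
  (a * p%:C + b * r%:C) *: u + (a * q%:C + b * s%:C) *: w.
Proof. by rewrite /rcomb !scalerDr !scalerA addrACA -!scalerDl. Qed.

Lemma rcomb_rcomb u w c s p q r t :
  rcomb (rcomb u w p q) (rcomb u w r t) c s =
  rcomb u w (c * p + s * r) (c * q + s * t).
Proof. by rewrite {1}/rcomb rcomb_comb /rcomb !rmorphD !rmorphM. Qed.

Lemma rcombZ u w c p q : c%:C *: rcomb u w p q = rcomb u w (c * p) (c * q).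
Proof. by rewrite /rcomb scalerDr !scalerA -!rmorphM. Qed.

Lemma rcomb_scale u w a c d : rcomb (a *: u) (a *: w) c d = a *: rcomb u w c d.
Proof. by rewrite /rcomb scalerDr !scalerA ![a * _]mulrC. Qed.

(** The coefficients are complex, although only the real ellipse with half-axes [u]
    and [w] is optimised: this is what bounds [N (u - i w)] and [N (u + i w)] by
    [sqrt 2], and these vectors are, up to sign, twice the pair with half-axes [u], [w]. *)
Definition ellipse_in_ball u w := forall a b,
  N (a *: u + b *: w) ^+ 2 <= Normc.normc a ^+ 2 + Normc.normc b ^+ 2.

Lemma ellipse_in_ball_rot u w c s : c ^+ 2 + s ^+ 2 = 1 ->
  ellipse_in_ball u w ->
  ellipse_in_ball (rcomb u w c s) (rcomb u w (- s) c).
Proof.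
move=> cs H a b; rewrite rcomb_comb; apply: le_trans (H _ _) _.
rewrite !normc_sqr; case: a b => [a1 a2] [b1 b2] /=.
rewrite -[leRHS]mul1r -cs; nra.
Qed.

(** When [N u < 1 / sqrt 2], the unit ball sticks out so far in the direction of [u] that
    an ellipse of larger area fits. For [2 < k] with [k (N u)^2 <= 1], mixing the
    ellipse with weight [1 - t] and the point [sqrt k u] with weight [t] gives, by
    convexity of the square, half-axes [sqrt (1 - t + t k) u] and [sqrt (1 - t) w].
    The product [(1 - t + t k) (1 - t)] has derivative [k - 2 > 0] at [t = 0]. *)
Lemma ellipse_stretch u w : ellipse_in_ball u w -> N u ^+ 2 < 1 / 2 ->
  exists al be : R, 1 < al * be /\ ellipse_in_ball (al%:C *: u) (be%:C *: w).
Proof.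
move=> H Nu.
(* Any [k] strictly above [2] and at most [1 / (N u)^2] works; this one is also defined
   when [N u = 0]. *)
pose k := 4 / (2 * N u ^+ 2 + 1).
have D0 : 0 < 2 * N u ^+ 2 + 1 by rewrite ltr_wpDl // mulr_ge0 // sqr_ge0.
have k2 : 2 < k by rewrite ltr_pdivlMr //; lra.
have k0 : 0 < k by lra.
have kN : k * N u ^+ 2 <= 1 by rewrite mulrAC ler_pdivrMr //; lra.
(* The maximiser of [(1 - t + t k) (1 - t)]. *)
pose t := (k - 2) / (2 * (k - 1)).
have tE : t * (2 * (k - 1)) = k - 2 by rewrite /t divfK //; lra.
have t0 : 0 < t by rewrite divr_gt0 //; lra.
have t1 : t < 1 / 2 by rewrite ltr_pdivrMr; lra.
pose x := 1 - t + t * k; pose y := 1 - t.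
have x0 : 0 < x by rewrite /x; nra.
have y0 : 0 < y by rewrite /y; lra.
have xy : 1 < x * y by rewrite /x /y; nra.
pose al := Num.sqrt x; pose be := Num.sqrt y.
have al0 : 0 < al by rewrite sqrtr_gt0.
have be0 : 0 < be by rewrite sqrtr_gt0.
have al2 : al ^+ 2 = x by rewrite sqr_sqrtr // ltW.
have be2 : be ^+ 2 = y by rewrite sqr_sqrtr // ltW.
exists al, be; split.
  rewrite -sqrtrM ?(ltW x0) // -sqrtr1 ltr_sqrt //; lra.
move=> a b; pose a' := a * al^-1%:C; pose b' := b * be^-1%:C.
have -> : a *: (al%:C *: u) + b *: (be%:C *: w) =
    y%:C *: (a' *: u + b' *: w) + ((t * k)%:C * a') *: u.
  rewrite scalerDr !scalerA addrAC -scalerDl; congr (_ *: _ + _ *: _).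
    rewrite -mulrDl -rmorphD -/x -al2 /a' mulrCA -!rmorphM; congr (_ * _%:C).
    by field; rewrite gt_eqF.
  rewrite -be2 /b' mulrCA -!rmorphM; congr (_ * _%:C).
  by field; rewrite gt_eqF.
set P := N (a' *: u + b' *: w); set Q := Normc.normc a' * N u.
have na : Normc.normc a = al * Normc.normc a'.
  rewrite /a' Normc.normcM normc_real gtr0_norm ?invr_gt0 // mulrCA divff ?mulr1 //.
  by rewrite gt_eqF.
have nb : Normc.normc b = be * Normc.normc b'.
  rewrite /b' Normc.normcM normc_real gtr0_norm ?invr_gt0 // mulrCA divff ?mulr1 //.
  by rewrite gt_eqF.
have tk0 : 0 < t * k := mulr_gt0 t0 k0.
have tri : N (y%:C *: (a' *: u + b' *: w) + ((t * k)%:C * a') *: u) <= y * P + t * (k * Q).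
  apply: le_trans (ND _ _) _; rewrite !NZ Normc.normcM !normc_real.
  by rewrite (gtr0_norm y0) (gtr0_norm tk0) (mulrA t k) /Q (mulrA (t * k)).
have P0 : 0 <= P := N0 _.
have P2 : P ^+ 2 <= Normc.normc a' ^+ 2 + Normc.normc b' ^+ 2 by exact: H.
have Q0 : 0 <= Q by rewrite mulr_ge0 ?normc_ge0 ?N0.
have Q2 : k * Q ^+ 2 <= Normc.normc a' ^+ 2.
  rewrite /Q exprMn mulrCA -[leRHS]mulr1 ler_wpM2l ?sqr_ge0 //.
apply: le_trans (_ : (y * P + t * (k * Q)) ^+ 2 <= _).
  by rewrite sqr_leE ?N0 //; apply: le_trans tri; exact: N0.
(* Convexity of the square, with weights [y = 1 - t] and [t]. *)
apply: le_trans (_ : y * P ^+ 2 + t * (k * Q) ^+ 2 <= _).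
  rewrite -subr_ge0 (_ : _ - _ = t * y * (P - k * Q) ^+ 2); last by rewrite /y; ring.
  by rewrite mulr_ge0 ?sqr_ge0 // ltW // mulr_gt0.
rewrite na nb (exprMn _ al) (exprMn _ be) al2 be2 /x.
have tk : t * (k * Q) ^+ 2 <= t * (k * Normc.normc a' ^+ 2).
  by rewrite (ler_pM2l t0) exprMn expr2 -(mulrA k k) (ler_pM2l k0).
have yP : y * P ^+ 2 <= y * (Normc.normc a' ^+ 2 + Normc.normc b' ^+ 2).
  by rewrite (ler_pM2l y0).
apply: le_trans (lerD yP tk) _; rewrite le_eqVlt; apply/orP; left; apply/eqP.
by rewrite /y; ring.
Qed.

Lemma seminorm_continuous_rcomb (T : topologicalType) u w (f g : T -> R) t a :
  {for t, continuous f} -> {for t, continuous g} ->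
  seminorm_continuous_at N (fun x => a *: rcomb u w (f x) (g x)) t.
Proof.
move=> cf cg; rewrite /rcomb.
have -> : (fun x => a *: ((f x)%:C *: u + (g x)%:C *: w)) =
  (fun x => (f x)%:C *: (a *: u) + (g x)%:C *: (a *: w)).
  by apply/funext => x; rewrite scalerDr !scalerA ![a * _]mulrC.
by apply: (seminorm_continuousD Nsemi); exact: (seminorm_continuousZ Nsemi).
Qed.

(** The half-axes of the ellipses inside the unit ball range over a set that is closed, by
    continuity of [N], and bounded, because [N] dominates [kap] times the Euclidean
    norm. So the determinant, which measures the area, has a maximum. It is positive
    since small discs lie inside. *)
Lemma ex_max_ellipse u w (kap : R) : 0 < kap ->
  (forall p q, kap ^+ 2 * (p ^+ 2 + q ^+ 2) <= N (rcomb u w p q) ^+ 2) ->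
  exists p q r s, [/\ ellipse_in_ball (rcomb u w p q) (rcomb u w r s),
    0 < p * s - q * r & forall p' q' r' s',
    ellipse_in_ball (rcomb u w p' q') (rcomb u w r' s') ->
    p' * s' - q' * r' <= p * s - q * r].
Proof.
move=> k0 Hk; pose TT := ((R * R) * (R * R))%type.
pose A := [set T : TT | ellipse_in_ball (rcomb u w T.1.1 T.1.2) (rcomb u w T.2.1 T.2.2)].
pose f (T : TT) : R := T.1.1 * T.2.2 - T.1.2 * T.2.1.
have c11 : continuous (fun T : TT => T.1.1).
  by move=> T; apply: (@cvg_comp _ _ _ fst fst); [exact: cvg_fst|exact: cvg_fst].
have c12 : continuous (fun T : TT => T.1.2).
  by move=> T; apply: (@cvg_comp _ _ _ fst snd); [exact: cvg_fst|exact: cvg_snd].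
have c21 : continuous (fun T : TT => T.2.1).
  by move=> T; apply: (@cvg_comp _ _ _ snd fst); [exact: cvg_snd|exact: cvg_fst].
have c22 : continuous (fun T : TT => T.2.2).
  by move=> T; apply: (@cvg_comp _ _ _ snd snd); [exact: cvg_snd|exact: cvg_snd].
have cf : continuous f.
  by move=> T; rewrite /f; apply: cvgB; apply: cvgM;
    first [exact: c11|exact: c12|exact: c21|exact: c22].
have clA : closed A.
  have -> : A = \bigcap_(ab : R[i] * R[i])
     ((fun T : TT => N (ab.1 *: rcomb u w T.1.1 T.1.2 + ab.2 *: rcomb u w T.2.1 T.2.2)) @^-1`
      [set x | x <= Num.sqrt (Normc.normc ab.1 ^+ 2 + Normc.normc ab.2 ^+ 2)]).
    have sE (x y : R) : 0 <= x -> 0 <= y -> (x ^+ 2 <= y) = (x <= Num.sqrt y).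
      by move=> x0 y0; rewrite -(sqr_leE (y := Num.sqrt y)) ?sqrtr_ge0 // sqr_sqrtr.
    apply/seteqP; split => T HT.
      by move=> [a b] _ /=; rewrite -sE ?N0 ?addr_ge0 ?sqr_ge0 //; exact: HT.
    by move=> a b; rewrite sE ?N0 ?addr_ge0 ?sqr_ge0 //; exact: (HT (a, b)).
  apply: closed_bigI => -[a b] _; apply: closed_comp; last exact: closed_le.
  move=> T _; apply: (continuous_seminorm Nsemi (F := fun T : TT =>
    a *: rcomb u w T.1.1 T.1.2 + b *: rcomb u w T.2.1 T.2.2)).
  by apply: (seminorm_continuousD Nsemi); apply: seminorm_continuous_rcomb;
    first [exact: c11|exact: c12|exact: c21|exact: c22].
have bnd p q : N (rcomb u w p q) ^+ 2 <= 1 -> `|p| <= kap^-1 /\ `|q| <= kap^-1.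
  move=> N1; have := le_trans (Hk p q) N1; rewrite mulrDr => H.
  have sq (x : R) : kap ^+ 2 * x ^+ 2 <= 1 -> `|x| <= kap^-1.
    move=> Hx; rewrite -[leRHS]mul1r ler_pdivlMr // -[X in _ * X](gtr0_norm k0) -normrM.
    by rewrite -(sqr_leE (y := 1)) // real_normK ?num_real // exprMn expr1n mulrC.
  have := mulr_ge0 (sqr_ge0 kap) (sqr_ge0 p); have := mulr_ge0 (sqr_ge0 kap) (sqr_ge0 q).
  by split; apply: sq; lra.
pose I := `[- kap^-1, kap^-1]%classic : set R.
have AI : A `<=` ((I `*` I) `*` (I `*` I)).
  move=> [[p q] [r s]] /= H.
  have := H 1 0; rewrite scale1r scale0r addr0 Normc.normc0 Normc.normc1 expr1n expr0n addr0.
  have := H 0 1; rewrite scale1r scale0r add0r Normc.normc0 Normc.normc1 expr1n expr0n add0r.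
  by move=> /bnd [r1 s1] /bnd [p1 q1]; rewrite /I /= !in_itv /= -!ler_norml.
have cA : compact A.
  have cI : compact I by exact: segment_compact.
  apply: (subclosed_compact clA _ AI); apply: compact_setX; exact: compact_setX.
pose e := (1 + N u + N w)^-1.
have e0 : 0 < e by rewrite invr_gt0; have := N0 u; have := N0 w; lra.
have eA : A ((e, 0), (0, e)).
  move=> a b; rewrite /= rcomb_comb !rmorph0 !mulr0 addr0 add0r.
  have eN : e * (N u + N w) <= 1.
    rewrite mulrC ler_pdivrMr ?mul1r; first lra.
    by rewrite -invr_gt0.
  set H := Normc.normc a ^+ 2 + _.
  have aH : Normc.normc a <= Num.sqrt H.
    by rewrite -[leLHS]ger0_norm ?normc_ge0 // -sqrtr_sqr ler_wsqrtr // lerDl sqr_ge0.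
  have bH : Normc.normc b <= Num.sqrt H.
    by rewrite -[leLHS]ger0_norm ?normc_ge0 // -sqrtr_sqr ler_wsqrtr // lerDr sqr_ge0.
  have H0 : 0 <= H by rewrite addr_ge0 ?sqr_ge0.
  rewrite -[leRHS]sqr_sqrtr // sqr_leE ?sqrtr_ge0 ?N0 //.
  apply: le_trans (ND _ _) _; rewrite !NZ !Normc.normcM !normc_real !(gtr0_norm e0).
  apply: le_trans (_ : Num.sqrt H * (e * (N u + N w)) <= _).
    by rewrite !mulrDr !mulrA lerD // ler_wpM2r ?N0 // ler_wpM2r // ltW.
  by rewrite -[leRHS]mulr1 ler_wpM2l ?sqrtr_ge0.
have [|[[p q] [r s]] TA Tmax] := compact_EVT_max _ cA (continuous_subspaceT cf).
  by exists ((e, 0), (0, e)).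
rewrite inE in TA; exists p, q, r, s; split => //.
  have := Tmax ((e, 0), (0, e)); rewrite inE => /(_ eA); rewrite /f /= mul0r subr0.
  by apply: lt_le_trans; rewrite mulr_gt0.
by move=> p' q' r' s' H; have := Tmax ((p', q'), (r', s')); rewrite inE; apply.
Qed.

(** John's theorem in the plane: the ellipse of maximal area inside the unit ball contains
    the ball of radius [1 / sqrt 2]. Otherwise, after rotating a boundary point of small
    norm to the first half-axis, [ellipse_stretch] would increase the area. *)
Lemma ex_John_ellipse u w (kap : R) : 0 < kap ->
  (forall p q, kap ^+ 2 * (p ^+ 2 + q ^+ 2) <= N (rcomb u w p q) ^+ 2) ->
  exists p q r s, let u' := rcomb u w p q in let w' := rcomb u w r s in
  [/\ 0 < p * s - q * r, ellipse_in_ball u' w' &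
    forall c d, c ^+ 2 + d ^+ 2 = 1 -> 1 / 2 <= N (rcomb u' w' c d) ^+ 2].
Proof.
move=> k0 Hk; have [p [q [r [s [H det0 Hmax]]]]] := ex_max_ellipse k0 Hk.
exists p, q, r, s; split => // c d cd; rewrite leNgt; apply/negP => lt.
have [al [be [ab]]] := ellipse_stretch (ellipse_in_ball_rot cd H) lt.
rewrite !rcomb_rcomb !rcombZ => /Hmax.
rewrite [leLHS](_ : _ = al * be * (c ^+ 2 + d ^+ 2) * (p * s - q * r)); last by ring.
rewrite cd mulr1 -[leRHS]mul1r ler_pM2r // => /(lt_le_trans ab).
by rewrite ltxx.
Qed.

End JohnEllipse.

(** * Spans of two vectors *)

Section Span.
Context (F : numDomainType) (V : lmodType F).
Implicit Types (f g x y : V) (a b : F).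

Lemma span2_comb f g x y a b :
  span2 f g x -> span2 f g y -> span2 f g (a *: x + b *: y).
Proof.
move=> [x1 [x2 ->]] [y1 [y2 ->]]; exists (a * x1 + b * y1), (a * x2 + b * y2).
by rewrite !scalerDr !scalerA addrACA -!scalerDl.
Qed.

Lemma span2Z f g x a : span2 f g x -> span2 f g (a *: x).
Proof. by move=> sx; rewrite -[_ *: x]addr0 -(scale0r x); exact: span2_comb. Qed.

Lemma span2_comb_self f g a b : span2 f g (a *: f + b *: g).
Proof. by exists a, b. Qed.

Lemma span2D f g : span2 f g (f + g).
Proof. by exists 1, 1; rewrite !scale1r. Qed.

Lemma span2B f g : span2 f g (f - g).
Proof. by exists 1, (-1); rewrite scaleN1r scale1r. Qed.

End Span.

(** * Real scalars *)

Section RealCase.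
Context (R : realType) (X : banachLatticeType R).
Implicit Types (f g h s u v : X).

Lemma real_phase_dist f g :
  phase_dist (fun x : X => `|x|) f g = Num.min `|f - g| `|f + g|.
Proof.
apply: minimum_eq.
  rewrite minEle; case: ifP => _; first by exists 1; rewrite /= ?normr1 ?scale1r.
  by exists (-1); rewrite /= ?normrN1 // scaleN1r opprK.
move=> _ [l /= l1 <-]; rewrite ge_min.
have [l0|l0] := ger0P l.
  by move: l1; rewrite ger0_norm // => ->; rewrite scale1r lexx.
move: l1; rewrite ltr0_norm // => /eqP; rewrite eqr_oppLR => /eqP ->.
by rewrite scaleN1r opprK lexx orbT.
Qed.

Lemma lmod_lmodB f g : lmod (lmod f - lmod g) <= lmod (f - g).
Proof.
rewrite lmod_le opprB !blat_leBlDr; apply/andP; split.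
  by rewrite -{1}(subrK g f) lmodD.
by rewrite -(lmodN (f - g)) opprB -{1}(subrK f g) lmodD.
Qed.

Lemma lmod_lmodD f g : lmod (lmod f - lmod g) <= lmod (f + g).
Proof. by rewrite -(lmodN g) -[g in X in _ <= X]opprK lmod_lmodB. Qed.

(** Real counterpart of [le_of_rotation_gaps]: the circle is [{1, -1}]. *)
Lemma le_of_sign_gaps f h s :
  h <= s + (lmod f - f) -> h <= s + (lmod f + f) -> h <= s.
Proof.
rewrite !(addrC s) -!blat_leBlDr => H1 H2.
suff : lmod f <= lmod f - (h - s).
  rewrite -(blat_leD2rE (- lmod f) (lmod f)) subrr addrAC subrr add0r opprB.
  by rewrite blat_subr_ge0.
rewrite opprK in H1; rewrite lmod_le; apply/andP; split.
  by rewrite -(blat_leD2rE (h - s) f) subrK addrC.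
by rewrite -(blat_leD2rE (h - s) (- f)) subrK addrC.
Qed.

(** The argument of [le_lmod_cmodB], with signs as rotations. The modulus of [x - |x|] is
    exactly the gap [|x| - x], so that no error [e] occurs. *)
Lemma le_lmod_lmodB f g h :
  h <= lmod (f - g) -> h <= lmod (f + g) -> h <= lmod (lmod f - lmod g).
Proof.
have gap (x y : X) : lmod (x - y) <=
    lmod (lmod x - lmod y) + (lmod x - x) + (lmod y - y).
  have gE (z : X) : lmod (z - lmod z) = lmod z - z.
    by rewrite -lmodN opprB lmod_id // blat_subr_ge0 le_lmod.
  have -> : x - y = (lmod x - lmod y) + (x - lmod x) + (- (y - lmod y)).
    by rewrite opprB [lmod x - _ + _]addrC !addrA !subrK.
  apply: le_trans (lmodD _ _) _; rewrite lmodN (gE y) blat_leD2rE.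
  by apply: le_trans (lmodD _ _) _; rewrite (gE x).
move=> H1 H2; apply: (@le_of_sign_gaps f); apply: (@le_of_sign_gaps g).
- exact: le_trans H1 (gap f g).
- by apply: le_trans H2 _; have := gap f (- g); rewrite lmodN !opprK.
- by apply: le_trans H2 _; have := gap (- f) g; rewrite lmodN !opprK -opprD lmodN.
- apply: le_trans H1 _; have := gap (- f) (- g).
  by rewrite !lmodN !opprK -(lmodN (- f + g)) opprD opprK.
Qed.

End RealCase.

Section RealMain.
Context (R : realType) (X : banachLatticeType R).
Implicit Types (f g u v : X).

(** Shrinking the longer diagonal [v] until it is as short as [u] leaves the
    phase distance unchanged and bounds the sides by it. *)
Lemma ex_balanced_pair u v : `|u| <= `|v| ->
  exists f' g' (t : R), [/\ span2 u v f' /\ span2 u v g',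
    f' - g' = u, 0 <= t <= 1 /\ f' + g' = t *: v,
    phase_dist (fun h : X => `|h|) f' g' = `|u| &
    `|f'| <= `|u| /\ `|g'| <= `|u|].
Proof.
move=> uv; pose t := `|u| / `|v|.
have tv : t * `|v| = `|u|.
  rewrite /t; have [v0|v0] := eqVneq `|v| 0; last by rewrite divfK.
  by apply/eqP; rewrite v0 mulr0 eq_le normr_ge0 /=; move: uv; rewrite v0.
have t01 : 0 <= t <= 1.
  rewrite divr_ge0 //= /t; have [->|v0] := eqVneq `|v| 0; first by rewrite invr0 mulr0.
  by rewrite ler_pdivrMr ?mul1r // lt_def v0 normr_ge0.
have ntv : `|t *: v| = `|u|.
  by rewrite normrZ ger0_norm ?tv //; case/andP: t01.
pose f' := 2^-1 *: u + (2^-1 * t) *: v; pose g' := (- 2^-1) *: u + (2^-1 * t) *: v.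
have half : 2^-1 + 2^-1 = 1 :> R by lra.
have fmg : f' - g' = u.
  by rewrite /f' /g' scaleNr opprD opprK addrACA subrr addr0 -scalerDl half scale1r.
have fpg : f' + g' = t *: v.
  by rewrite /f' /g' scaleNr addrACA subrr add0r -scalerDl -mulrDl half mul1r.
have h0 : 0 <= 2^-1 :> R by rewrite invr_ge0.
exists f', g', t; split => //.
- by split; apply: span2_comb_self.
- by rewrite real_phase_dist fmg fpg ntv minxx.
- split; apply: le_trans (ler_normD _ _) _; rewrite -scalerA;
    rewrite [`|2^-1 *: (t *: v)|]normrZ ntv normrZ ?normrN ger0_norm //; lra.
Qed.

Lemma real_case f g : exists f' g' : X, span2 f g f' /\ span2 f g g' /\
  phase_dist (fun h : X => `|h|) f g
    <= Num.sqrt 2 * phase_dist (fun h : X => `|h|) f' g' /\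
  Num.sqrt (`|f'| ^+ 2 + `|g'| ^+ 2)
    <= Num.sqrt 2 * phase_dist (fun h : X => `|h|) f' g' /\
  `|lmod f' - lmod g'| <= `|lmod f - lmod g|.
Proof.
have s2 : 1 <= Num.sqrt 2 :> R by rewrite -[leLHS]sqrtr1 ler_wsqrtr // ler1n.
have main u v : `|u| <= `|v| -> phase_dist (fun h : X => `|h|) f g = `|u| ->
    span2 f g u -> span2 f g v ->
    (forall h, h <= lmod u -> h <= lmod v -> h <= lmod (lmod f - lmod g)) ->
    exists f' g' : X, span2 f g f' /\ span2 f g g' /\
    phase_dist (fun h : X => `|h|) f g
      <= Num.sqrt 2 * phase_dist (fun h : X => `|h|) f' g' /\
    Num.sqrt (`|f'| ^+ 2 + `|g'| ^+ 2)
      <= Num.sqrt 2 * phase_dist (fun h : X => `|h|) f' g' /\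
    `|lmod f' - lmod g'| <= `|lmod f - lmod g|.
  move=> uv dE su sv glb.
  have [f' [g' [t [[sf sg] fmg [/andP[t0 t1] fpg] d' [nf ng]]]]] := ex_balanced_pair uv.
  have span h : span2 u v h -> span2 f g h by case=> a [b ->]; exact: span2_comb.
  exists f', g'; split; first exact: span; split; first exact: span.
  rewrite dE d'; split; first by rewrite ler_peMl.
  split.
    rewrite -(ger0_norm (normr_ge0 u)) -[X in _ * X]sqrtr_sqr -sqrtrM // ler_wsqrtr //.
    have := normr_ge0 f'; have := normr_ge0 g'; nra.
  apply: norm_le_lmod; apply: glb; first by rewrite -fmg lmod_lmodB.
  apply: le_trans (lmod_lmodD _ _) _; rewrite fpg; apply: le_trans (lmodZ _ _) _.
  by rewrite ger0_norm // -[X in _ <= X]scale1r blat_leZl ?lmod_ge0.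
have [uv|vu] := leP `|f - g| `|f + g|.
  apply: (main (f - g) (f + g)) => //; first by rewrite real_phase_dist min_l.
  - exact: span2B.
  - exact: span2D.
  - by move=> h; exact: le_lmod_lmodB.
apply: (main (f + g) (f - g)); first exact: ltW.
- by rewrite real_phase_dist min_r // ltW.
- exact: span2D.
- exact: span2B.
- by move=> h h1 h2; exact: le_lmod_lmodB.
Qed.

End RealMain.

(** * Complex scalars *)

Section ComplexMain.
Local Open Scope complex_scope.
Context (R : realType) (V : lmodType R[i]) (N : V -> R) (Nsemi : seminorm N).
Implicit Types (f g u w : V) (p q c d : R).

Lemma seminorm_ellipse_ge u w (kap : R) : 0 <= kap ->
  (forall p q, p ^+ 2 + q ^+ 2 = 1 -> kap <= N (rcomb u w p q)) ->
  forall p q, kap ^+ 2 * (p ^+ 2 + q ^+ 2) <= N (rcomb u w p q) ^+ 2.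
Proof.
move=> k0 H p q; set D := p ^+ 2 + q ^+ 2.
have D0 : 0 <= D by rewrite addr_ge0 ?sqr_ge0.
have [->|Dn] := eqVneq D 0; first by rewrite mulr0 sqr_ge0.
pose r := Num.sqrt D; have r2 : r ^+ 2 = D by rewrite sqr_sqrtr.
have r0 : 0 < r by rewrite sqrtr_gt0 lt_def Dn.
have rn : r != 0 by rewrite gt_eqF.
have -> : rcomb u w p q = r%:C *: rcomb u w (p / r) (q / r).
  by rewrite rcombZ; congr rcomb; rewrite mulrC divfK.
rewrite (seminormZ Nsemi) normc_real gtr0_norm // exprMn mulrC r2 ler_wpM2l //.
rewrite sqr_leE //; last exact: (seminorm_ge0 Nsemi).
  by apply: H; rewrite !expr_div_n -mulrDl -/D -r2 divff // expf_neq0.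
Qed.

Lemma phase_dist_gt0 f g : (forall x, N x = 0 -> x = 0) -> lin_indep2 f g ->
  0 < phase_dist N f g.
Proof.
move=> Ndef fg; have [l [_ [-> _]]] := phase_dist_attained Nsemi f g.
rewrite lt_def (seminorm_ge0 Nsemi) andbT; apply/eqP => /Ndef; rewrite -scaleNr -{1}(scale1r f).
by move/fg => [/eqP]; rewrite oner_eq0.
Qed.

(** The solution of [f - g = u] and [i (f + g) = w]. Unit coefficients are kept so that
    [ellipse_in_ball] and [span2_comb] apply to it literally. *)
Definition pair_of_axes u w : V * V :=
  ((2^-1)%:C *: (1 *: u + (- 'i) *: w), (2^-1)%:C *: (-1 *: u + (- 'i) *: w)).

Lemma pair_of_axes_sub u w : (pair_of_axes u w).1 - (pair_of_axes u w).2 = u.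
Proof.
rewrite /= -scalerBr opprD addrACA -!scalerBl subrr scale0r addr0 scalerA.
rewrite (_ : _ * _ = 1) ?scale1r //; apply/eqP; rewrite eq_complex /=.
by apply/andP; split; apply/eqP => /=; lra.
Qed.

Lemma pair_of_axes_add u w :
  'i *: ((pair_of_axes u w).1 + (pair_of_axes u w).2) = w.
Proof.
rewrite /= -scalerDr addrACA -!scalerDl subrr scale0r add0r !scalerA.
rewrite (_ : _ * _ = 1) ?scale1r //; apply/eqP; rewrite eq_complex /=.
by apply/andP; split; apply/eqP => /=; lra.
Qed.

(** The two members are [(u - i w) / 2] and [- (u + i w) / 2], and both numerators have
    coefficients of total square modulus [2]. *)
Lemma pair_of_axes_norm u w : ellipse_in_ball N u w ->
  N (pair_of_axes u w).1 ^+ 2 <= 1 / 2 /\ N (pair_of_axes u w).2 ^+ 2 <= 1 / 2.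
Proof.
move=> H; have hn : `|2^-1| = 2^-1 :> R by rewrite ger0_norm // invr_ge0.
have h2 (x : R) : x ^+ 2 <= 2 -> (2^-1 * x) ^+ 2 <= 1 / 2 by move=> ?; nra.
split; rewrite /= (seminormZ Nsemi) normc_real hn; apply: h2;
  by apply: le_trans (H _ _) _; rewrite !normc_sqr /=; lra.
Qed.

End ComplexMain.

Section ComplexCase.
Local Open Scope complex_scope.
Context (R : realType) (X : banachLatticeType R).
Local Notation XC := (complexification X).
Implicit Types (f g u w : XC).

Lemma cnorm_seminorm : seminorm (@cnorm R X).
Proof. by split; [exact: cnormD | exact: cnormZ]. Qed.

(** The difference of moduli is the inner radius of the phase ellipse in the sense of
    [cmod], by [lmod_cmodB] and [le_lmod_cmodB]; it can only decrease when the boundary of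
    the ellipse moves inwards. *)
Lemma lmod_cmodB_mono f g f' g' :
  (forall c d : R, c ^+ 2 + d ^+ 2 = 1 ->
     exists (rho c' d' : R), [/\ 1 <= rho, c' ^+ 2 + d' ^+ 2 = 1 &
       rcomb (f - g) ('i *: (f + g)) c d =
       rho%:C *: rcomb (f' - g') ('i *: (f' + g')) c' d']) ->
  lmod (cmod f' - cmod g') <= lmod (cmod f - cmod g).
Proof.
move=> H; apply: le_lmod_cmodB => l /phase_circle [c [d [cd ->]]].
rewrite phase_ellipse // cmod_unit ?normc_unit //.
have [rho [c' [d' [rho1 cd' ->]]]] := H _ _ cd.
rewrite cmodZ normc_real ger0_norm; last by lra.
apply: (@le_trans _ _ (cmod (rcomb (f' - g') ('i *: (f' + g')) c' d'))); last first.
  by rewrite -{1}[cmod _]scale1r blat_leZl // cmod_ge0.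
rewrite -(@cmod_unit _ _ (c' -i* d') (rcomb _ _ _ _)) ?normc_unit // -phase_ellipse //.
apply: le_trans (lmod_cmodB _ _); rewrite cmod_unit //.
by rewrite expr2 Normc.normcM normc_unit // mulr1.
Qed.

Lemma complex_case f g : lin_indep2 f g ->
  exists f' g' : XC, span2 f g f' /\ span2 f g g' /\
  phase_dist (@cnorm R X) f g <= Num.sqrt 2 * phase_dist (@cnorm R X) f' g' /\
  Num.sqrt (cnorm f' ^+ 2 + cnorm g' ^+ 2)
    <= Num.sqrt 2 * phase_dist (@cnorm R X) f' g' /\
  `|cmod f' - cmod g'| <= `|cmod f - cmod g|.
Proof.
move=> fg; have Ns := cnorm_seminorm; set N := @cnorm R X in Ns *.
pose u := f - g; pose w := 'i *: (f + g).
have [_ ge_a] := phase_dist_ellipse Ns f g.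
have a0 := phase_dist_gt0 Ns (@cnorm_eq0 R X) fg.
move: ge_a a0; rewrite -/u -/w; set a := phase_dist N f g => ge_a a0.
have [p [q [r [s]]]] := ex_John_ellipse Ns a0 (seminorm_ellipse_ge Ns (ltW a0) ge_a).
set u0 := rcomb u w p q; set w0 := rcomb u w r s => /= -[det0 inB outB].
set P := pair_of_axes u0 w0.
pose f' := a%:C *: P.1; pose g' := a%:C *: P.2.
have fmg : f' - g' = a%:C *: u0 by rewrite -scalerBr pair_of_axes_sub.
have fpg : 'i *: (f' + g') = a%:C *: w0.
  by rewrite -scalerDr scalerA [_ * a%:C]mulrC -scalerA pair_of_axes_add.
have ellE c d : rcomb (f' - g') ('i *: (f' + g')) c d = a%:C *: rcomb u0 w0 c d.
  by rewrite fmg fpg rcomb_scale.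
have su0 : span2 f g u0.
  apply: span2_comb; first exact: span2B.
  by apply: span2Z; exact: span2D.
have sw0 : span2 f g w0.
  apply: span2_comb; first exact: span2B.
  by apply: span2Z; exact: span2D.
have sf' : span2 f g f'.
  do 2!apply: span2Z; exact: span2_comb.
have sg' : span2 f g g'.
  do 2!apply: span2Z; exact: span2_comb.
have d'2 : a ^+ 2 <= 2 * phase_dist N f' g' ^+ 2.
  have [[c [d [cd ->]]] _] := phase_dist_ellipse Ns f' g'.
  rewrite ellE (seminormZ Ns) normc_real gtr0_norm // exprMn.
  by have := outB _ _ cd; have := exprn_gt0 2 a0; nra.
have d'0 : 0 <= phase_dist N f' g'.
  have [[c [d [cd ->]]] _] := phase_dist_ellipse Ns f' g'.
  exact: (seminorm_ge0 Ns).
have d' : a <= Num.sqrt 2 * phase_dist N f' g'.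
  rewrite -sqr_leE ?(ltW a0) //; last by rewrite mulr_ge0 ?sqrtr_ge0.
  by rewrite exprMn sqr_sqrtr.
exists f', g'; split => //; split => //; split => //; split.
  apply: le_trans d'; rewrite -[leRHS]gtr0_norm // -sqrtr_sqr ler_wsqrtr //.
  have [n1 n2] := pair_of_axes_norm Ns inB.
  rewrite -/N (seminormZ Ns _ P.1) (seminormZ Ns _ P.2) normc_real gtr0_norm //.
  rewrite !exprMn -mulrDr -[leRHS]mulr1 ler_wpM2l ?sqr_ge0 //.
  by move: n1 n2; rewrite -/P; lra.
apply: norm_le_lmod; apply: lmod_cmodB_mono => c d cd; rewrite -/u -/w.
(* Coordinates of a boundary point of the first ellipse with respect to the second; they
   have norm at least [a] because that point has [N]-norm at least [a]. *)
pose D := p * s - q * r; have Dn : D != 0 by rewrite gt_eqF.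
pose al := (c * s - d * r) / D; pose be := (p * d - q * c) / D.
have E : rcomb u w c d = rcomb u0 w0 al be.
  by rewrite rcomb_rcomb; congr rcomb; rewrite /al /be /D; field.
pose rho := Num.sqrt (al ^+ 2 + be ^+ 2).
have S0 : 0 <= al ^+ 2 + be ^+ 2 by rewrite addr_ge0 ?sqr_ge0.
have rho2 : rho ^+ 2 = al ^+ 2 + be ^+ 2 by rewrite sqr_sqrtr.
have arho : a <= rho.
  apply: le_trans (ge_a _ _ cd) _; rewrite E -sqr_leE ?sqrtr_ge0 ?(seminorm_ge0 Ns) //.
  apply: le_trans (inB _ _) _; rewrite rho2 !normc_sqr /= expr0n !addr0.
  by [].
have rho0 : 0 < rho by exact: lt_le_trans arho.
exists (rho / a), (al / rho), (be / rho); split.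
- by rewrite ler_pdivlMr ?mul1r.
- by rewrite (expr_div_n al) (expr_div_n be) -mulrDl -rho2 divff // expf_neq0 // gt_eqF.
- rewrite ellE scalerA -rmorphM divfK ?gt_eqF // rcombZ E; congr rcomb.
  + by rewrite mulrC divfK // gt_eqF.
  + by rewrite mulrC divfK // gt_eqF.
Qed.

End ComplexCase.

Theorem theorem3p9 (R : realType) (X : banachLatticeType R) :
  (exists K : R, 1 <= K <= Num.sqrt 2 /\
    forall f g : X, lin_indep2 f g ->
    exists f' g' : X, span2 f g f' /\ span2 f g g' /\
      phase_dist (fun h : X => `|h|) f g
        <= K * phase_dist (fun h : X => `|h|) f' g' /\
      Num.sqrt (`|f'| ^+ 2 + `|g'| ^+ 2)
        <= K * phase_dist (fun h : X => `|h|) f' g' /\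
      `|lmod f' - lmod g'| <= `|lmod f - lmod g|)
  /\
  (exists K : R, 1 <= K <= Num.sqrt 2 /\
    forall f g : complexification X, lin_indep2 f g ->
    exists f' g' : complexification X, span2 f g f' /\ span2 f g g' /\
      phase_dist (@cnorm R X) f g <= K * phase_dist (@cnorm R X) f' g' /\
      Num.sqrt (cnorm f' ^+ 2 + cnorm g' ^+ 2)
        <= K * phase_dist (@cnorm R X) f' g' /\
      `|cmod f' - cmod g'| <= `|cmod f - cmod g|).
Proof.
have s2 : 1 <= Num.sqrt (2 : R) <= Num.sqrt 2.
  by rewrite lexx andbT -[leLHS]sqrtr1 ler_wsqrtr // ler1n.
by split; exists (Num.sqrt 2); split => // f g fg; [exact: real_case | exact: complex_case].
Qed.
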